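(* Let $\mathbf w=(w_n)_{n\in\mathbb Z_+}$ be a bounded sequence of positive real numbers, and let $B_{\mathbf w}$ be the unilateral weighted shift on $c_0(\mathbb Z_+)$ defined by $B_{\mathbf w}(e_n)=w_ne_{n-1}$ for $n\ge1$ and $B_{\mathbf w}(e_0)=0$. Then $B_{\mathbf w}$ is frequently hypercyclic (resp. $\mathcal U$-frequently hypercyclic) on $c_0(\mathbb Z_+)$ if and only if there exist a sequence $(M(p))_{p\ge1}$ of positive real numbers tending to $+\infty$ and a sequence $(E_p)_{p\ge1}$ of subsets of $\mathbb Z_+$ such that (a) for any $p\geq 1$, $\underline d(E_p)>0$ (resp. $\bar d(E_p)>0$); (b) for any $p,q\geq 1$ with $p\neq q$, $(E_p+[0,p])\cap (E_q+[0,q])=\emptyset$; (c) for any $p\ge1$, $\lim_{n\to+\infty,\ n\in E_p+[0,p]}w_1\cdots w_n=+\infty$; (d) for any $p,q\geq 1$, any $n\in E_p$ and any $m\in E_q$ with $m>n$, and any $t\in\{0,\dots,q\}$, $$w_1\cdots w_{m-n+t}\geq M(p)M(q).$$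
   Context: $(e_n)_{n\in\mathbb Z_+}$ is the standard basis of $c_0(\mathbb Z_+)$ (sequences tending to $0$, sup norm), $\mathbb Z_+=\{0,1,2,\dots\}$. Intervals such as $[0,p]$ are intervals of integers. For $A\subset\mathbb Z_+$ let $A(n)=\{a\in A: a\le n\}$, $\underline d(A)=\liminf_{n\to+\infty}\frac{\#A(n)}{n}$ (lower density) and $\bar d(A)=\limsup_{n\to+\infty}\frac{\#A(n)}{n}$ (upper density). A bounded operator $T$ on a Banach space $X$ is frequently hypercyclic (resp. $\mathcal U$-frequently hypercyclic) if there is a vector $x\in X$ such that for every nonempty open $U\subset X$ the set $\{n\in\mathbb Z_+: T^nx\in U\}$ has positive lower density (resp. positive upper density). *)

(* Defs.v *)
From HB Require Import structures.
From mathcomp Require Import all_boot all_order all_algebra.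
From mathcomp.real_closed Require Import complex.
From mathcomp Require Import all_classical all_reals all_analysis.

Set Implicit Arguments.
Unset Strict Implicit.
Unset Printing Implicit Defensive.

Import Order.TTheory GRing.Theory Num.Theory.
Import numFieldNormedType.Exports.

Local Open Scope classical_set_scope.
Local Open Scope ring_scope.

(* The value at n = 0, where one divides by 0, does not affect the limits. *)
Definition density_seq (R : realType) (A : set nat) (n : nat) : \bar R :=
  (#|[pred a : 'I_n.+1 | (a : nat) \in A]|%:R / n%:R)%:E.

Definition lower_density (R : realType) (A : set nat) : \bar R :=
  limn_einf (density_seq R A).

Definition upper_density (R : realType) (A : set nat) : \bar R :=
  limn_esup (density_seq R A).

Definition frequently_hypercyclic (R : realType) (X : topologicalType)
    (T : X -> X) : Prop :=
  exists x : X, forall U : set X, open U -> U !=set0 ->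
    (0 < lower_density R [set n | U (iter n T x)])%E.

Definition U_frequently_hypercyclic (R : realType) (X : topologicalType)
    (T : X -> X) : Prop :=
  exists x : X, forall U : set X, open U -> U !=set0 ->
    (0 < upper_density R [set n | U (iter n T x)])%E.

(* Scalars are real or complex; the second index embeds the real weights. *)
Inductive real_or_complex (R : realType) :
    forall K : numFieldType, (R -> K) -> Prop :=
| RealScalars : @real_or_complex R R id
| ComplexScalars : @real_or_complex R R[i] (real_complex R).

Definition null_seq (K : numFieldType) : {pred nat -> K} :=
  fun x : nat -> K => `[< x n @[n --> \oo] --> (0 : K) >].

Lemma null_seq_submod_closed (K : numFieldType) : submod_closed (@null_seq K).
Proof.
split; first by apply/asboolP; exact: (@cvg_cst _ (0 : K)).
move=> a x y /asboolP x0 /asboolP y0; apply/asboolP.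
have -> : (0 : K) = a * 0 + 0 by rewrite mulr0 addr0.
by apply: cvgD => //; apply: cvgM => //; exact: cvg_cst.
Qed.

HB.instance Definition _ (K : numFieldType) :=
  GRing.isSubmodClosed.Build K (nat -> K) (@null_seq K)
    (null_seq_submod_closed K).

Record c0 (K : numFieldType) : Type :=
  MkC0 { c0_seq :> nat -> K ; c0_seqP : c0_seq \in @null_seq K }.

HB.instance Definition _ (K : numFieldType) := [isSub for @c0_seq K].
HB.instance Definition _ (K : numFieldType) := [Choice of c0 K by <:].
HB.instance Definition _ (K : numFieldType) :=
  [SubChoice_isSubLmodule of c0 K by <:].

Lemma c0_cvg (K : numFieldType) (x : c0 K) : x n @[n --> \oo] --> (0 : K).
Proof. by case: x => x /= /asboolP. Qed.

Lemma c0_inj (K : numFieldType) (x y : c0 K) : (forall n, x n = y n) -> x = y.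
Proof. by move=> xy; apply/val_inj/funext. Qed.

Definition c0_norm (K : numFieldType) (x : c0 K) : K :=
  supremum 0 [set `|x n| | n in [set: nat]].

Lemma c0_norm_attained (K : numFieldType) (x : c0 K) :
  exists2 n, c0_norm x = `|x n| & forall m, `|x m| <= `|x n|.
Proof.
have [n xn] : exists n, forall m, `|x m| <= `|x n|.
  have H : forall N, exists n, forall m, (m <= N)%N -> `|x m| <= `|x n|.
    elim=> [|N [n nP]]; first by exists 0%N => m; rewrite leqn0 => /eqP ->.
    have [le|lt] := real_leP (normr_real (x N.+1)) (normr_real (x n)).
      exists n => m; rewrite leq_eqVlt => /predU1P[->//|]; exact: nP.
    exists N.+1 => m; rewrite leq_eqVlt => /predU1P[->//|mN].
    exact: le_trans (nP _ mN) (ltW lt).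
  have [[k xk]|x0] := pselect (exists k, x k != 0); last first.
    exists 0%N => m; have [->|xm] := eqVneq (x m) 0.
      by rewrite normr0.
    by case: x0; exists m.
  have /cvgrPdist_lt/(_ `|x k|) := @c0_cvg K x.
  rewrite normr_gt0 => /(_ xk)[N _ Nx].
  have [n nP] := H (maxn N k).
  exists n => m; have [mN|mN] := leqP N m.
    have := Nx m mN; rewrite /= sub0r normrN => /ltW /le_trans; apply.
    by apply: nP; rewrite leq_maxr.
  by apply: nP; rewrite leq_max (ltnW mN).
exists n => //; rewrite /c0_norm /supremum ifF; last first.
  by apply/eqP; rewrite predeqE => /(_ `|x n|)[+ _]; apply; exists n.
have sn : supremums [set `|x n| | n in [set: nat]] `|x n|.
  split=> [_ [m _ <-]//|u]; apply; by exists n.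
apply: (is_subset1_supremums _ sn).
by apply: xgetPex; exists `|x n|.
Qed.

Lemma c0_norm_ge (K : numFieldType) (x : c0 K) n : `|x n| <= c0_norm x.
Proof. by have [m ->] := c0_norm_attained x. Qed.

Lemma c0_norm_le (K : numFieldType) (x : c0 K) (a : K) :
  (forall n, `|x n| <= a) -> c0_norm x <= a.
Proof. by have [m ->] := c0_norm_attained x. Qed.

Lemma c0_normD (K : numFieldType) (x y : c0 K) :
  c0_norm (x + y) <= c0_norm x + c0_norm y.
Proof.
apply: c0_norm_le => n; apply: le_trans (ler_normD _ _) _.
by apply: lerD; exact: c0_norm_ge.
Qed.

Lemma c0_normZ (K : numFieldType) (a : K) (x : c0 K) :
  c0_norm (a *: x) = `|a| * c0_norm x.
Proof.
apply/le_anti/andP; split.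
  by apply: c0_norm_le => n; rewrite normrM ler_wpM2l// c0_norm_ge.
have [n -> _] := c0_norm_attained x.
by rewrite -normrM (c0_norm_ge (a *: x) n).
Qed.

Lemma c0_norm_eq0 (K : numFieldType) (x : c0 K) : c0_norm x = 0 -> x = 0.
Proof.
move=> x0; apply: c0_inj => n.
by apply/eqP; rewrite -normr_le0 -x0 c0_norm_ge.
Qed.

HB.instance Definition _ (K : numFieldType) :=
  Lmodule_isNormed.Build K (c0 K)
    (@c0_normD K) (@c0_normZ K) (@c0_norm_eq0 K).

Lemma c0_basis_subproof (K : numFieldType) (n : nat) :
  (fun m => (m == n)%:R : K) \in @null_seq K.
Proof.
apply/asboolP; apply: cvg_near_cst.
by exists n.+1 => // m /= nm; rewrite gtn_eqF.
Qed.

Definition c0_basis (K : numFieldType) (n : nat) : c0 K :=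
  MkC0 (c0_basis_subproof K n).

Record is_weighted_shift (K : numFieldType) (w : nat -> K)
    (B : {linear c0 K -> c0 K}) : Prop := IsWeightedShift {
  weighted_shift_continuous : continuous B ;
  weighted_shift0 : B (c0_basis K 0) = 0 ;
  weighted_shiftS : forall n,
    B (c0_basis K n.+1) = w n.+1 *: c0_basis K n }.

Lemma bounded_weighted_shift_exists (K : numFieldType) (w : nat -> K) :
  bounded_fun w -> exists B : {linear c0 K -> c0 K}, is_weighted_shift w B.
Proof.
move=> [M [_ Mw]]; pose C := M + 1.
have wC n : `|w n| <= C by apply: (Mw C) => //; rewrite ltrDl.
have C0 : 0 <= C by exact: le_trans (wC 0%N).
have bP (x : c0 K) : (fun n => w n.+1 * x n.+1) \in @null_seq K.
  apply/asboolP/cvgr0Pnorm_lt => e e0.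
  have eC : 0 < e / (C + 1) by rewrite divr_gt0// ltr_wpDl.
  have /cvgr0Pnorm_lt/(_ _ eC)[N _ Nx] := @c0_cvg K x.
  exists N => // n /= Nn; rewrite normrM.
  have xn : `|x n.+1| < e / (C + 1) by apply: Nx => /=; exact: leqW.
  apply: (@le_lt_trans _ _ ((C + 1) * `|x n.+1|)).
    by apply: ler_wpM2r => //; rewrite ler_wpDr.
  by rewrite mulrC -ltr_pdivlMr// ltr_wpDl.
pose b x := MkC0 (bP x).
have b_linear : linear b.
  by move=> a x y; apply: c0_inj => n /=; rewrite mulrDr mulrCA.
pose bL := GRing.isLinear.Build K (c0 K) (c0 K) *:%R b b_linear.
pose B : {linear c0 K -> c0 K} := HB.pack b bL.
exists B; split.
- apply: bounded_linear_continuous; apply/linear_boundedP.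
  exists C; split; first exact: ger0_real.
  move=> r /ltW Cr x; apply: c0_norm_le => n /=.
  rewrite normrM; apply: ler_pM => //; first exact: le_trans (wC _) Cr.
  exact: c0_norm_ge.
- by apply: c0_inj => n; exact: mulr0.
- move=> n; apply: c0_inj => m /=; rewrite eqSS.
  rewrite -[RHS]/(w n.+1 * (m == n)%:R).
  by have [->//|_] := eqVneq m n; rewrite !mulr0.
Qed.

Lemma weighted_shift_exists (R : realType) (K : numFieldType) (iota : R -> K)
    (w : nat -> R) :
  real_or_complex iota -> bounded_fun w ->
  exists B : {linear c0 K -> c0 K}, is_weighted_shift (fun n => iota (w n)) B.
Proof.
move=> iotaP [M [_ Mw]]; apply: bounded_weighted_shift_exists.
have {}Mw n : `|w n| <= M + 1 by apply: Mw => //; rewrite ltrDl.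
case: K iota / iotaP.
  exists (M + 1); split=> [|r Mr n _ /=]; first exact: num_real.
  exact: le_trans (Mw n) (ltW Mr).
exists (M + 1)%:C%C; split=> [|r Mr n _ /=].
  by apply/ger0_real; rewrite lecR (le_trans _ (Mw 0%N)).
apply: le_trans _ (ltW Mr).
by rewrite normc_def /= expr0n addr0 sqrtr_sqr lecR.
Qed.

Definition interval_sum (E : set nat) (p : nat) : set nat :=
  [set (a + t)%N | a in E & t in [set t | (t <= p)%N]].

(* [M] and [E] are indexed by p >= 1; their values at 0 are irrelevant. *)
Definition shift_condition (R : realType) (dens : set nat -> \bar R)
    (w : nat -> R) : Prop :=
  exists (M : nat -> R) (E : nat -> set nat),
  [/\ forall p, (1 <= p)%N -> 0 < M p, M p @[p --> \oo] --> +oo &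
   [/\
    forall p, (1 <= p)%N -> (0 < dens (E p))%E,
    forall p q, (1 <= p)%N -> (1 <= q)%N -> p <> q ->
      interval_sum (E p) p `&` interval_sum (E q) q = set0,
    forall p, (1 <= p)%N ->
      \prod_(1 <= i < n.+1) w i
        @[n --> within (interval_sum (E p) p) \oo] --> +oo &
    forall p q n m t, (1 <= p)%N -> (1 <= q)%N -> E p n -> E q m ->
      (n < m)%N -> (t <= q)%N ->
      M p * M q <= \prod_(1 <= i < (m - n + t).+1) w i]].

(* Main.v *)
(* Write W n = w_1 ... w_n, so that W s * (B^n x)_s = W (n + s) * x_(n + s).

   From an orbit to the sets E_p: take E_p to be the visit times of a small ball
   around y_p = sum_(s <= p) ((p^2 + s + 1) / W s) e_s.  For n in E_p and s <= p
   the number W (n + s) * x_(n + s) is within 1/2 of the integer p^2 + s + 1,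
   and these integers are pairwise distinct, so that n + s determines p and s; this
   gives (b), and it shows that m - n + t > p in (d), where the coordinate
   (B^n x)_(m - n + t) is then small and W (m - n + t) large.

   From the sets to a vector: let y_j, supported in [0, j], be a dense sequence
   of finite sequences.  Pass to a sparse subsequence E_(phi j) with M (phi j)
   large with respect to y_j and to W on [0, j], and drop finitely many of its
   elements to get F_j.  Then the x defined by
   W (m + t) * x_(m + t) = W t * (y_j)_t for m in F_j and t <= j is a null
   sequence by (c), and by (b) and (d) its orbit visits a 1/(j+1)-neighbourhood
   of y_j at all times in F_j. *)

Require Import Defs.
From HB Require Import structures.
From mathcomp Require Import all_boot all_order all_algebra.
From mathcomp.real_closed Require Import complex.
From mathcomp Require Import zify.
From mathcomp Require Import all_classical all_reals all_analysis.

Set Implicit Arguments.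
Unset Strict Implicit.
Unset Printing Implicit Defensive.

Import Order.TTheory GRing.Theory Num.Theory.
Import numFieldNormedType.Exports.

Local Open Scope classical_set_scope.
Local Open Scope ring_scope.

(** * Positive densities and the effect of dropping finitely many integers *)

Lemma limn_einf_gt0P (R : realType) (u : nat -> \bar R) :
  (0 < limn_einf u)%E <->
  exists2 c : R, 0 < c & \forall n \near \oo, (c%:E <= u n)%E.
Proof.
rewrite /limn_einf oppe_gt0 /limn_esup /limf_esup; split.
  move=> /ereal_inf_lt[_ [V VF <-]] s0.
  have [c c0 sc] : exists2 c : R, 0 < c &
      (ereal_sup ((\- u)%E @` V) <= (- c)%:E)%E.
    (* A negative supremum is finite or -oo; in the latter case c = 1 serves. *)
    move: s0; case: ereal_sup => [r|//|_]; last by exists 1; rewrite // leNye.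
    rewrite lte_fin => r0; exists (- r); rewrite ?oppr_gt0// opprK.
    exact: lexx.
  exists c => //; apply: filterS VF => n Vn.
  rewrite -leeN2 -EFinN; apply: le_trans sc.
  by apply: ereal_sup_ubound; exists n.
move=> [c c0 cu].
apply: (@le_lt_trans _ _ (- c%:E)%E); last by rewrite oppe_lt0 lte_fin.
apply: le_trans.
  by apply: ereal_inf_lbound; exists [set n | (c%:E <= u n)%E].
by apply: ge_ereal_sup => _ [n /= cun <-]; rewrite EFinN leeN2.
Qed.

Lemma limn_esup_gt0P (R : realType) (u : nat -> \bar R) :
  (0 < limn_esup u)%E <->
  exists2 c : R, 0 < c & forall N, exists2 n, (N <= n)%N & (c%:E <= u n)%E.
Proof.
rewrite /limn_esup /limf_esup; split.
  move=> s0.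
  have [c c0 cs] : exists2 c : R, 0 < c & 
      (c%:E < ereal_inf [set ereal_sup (u @` V) | V in \oo])%E.
    move: s0; case: ereal_inf => [r|_|//]; last by exists 1; rewrite // ltry.
    rewrite lte_fin => r0; exists (r / 2); rewrite ?divr_gt0// lte_fin.
    by rewrite ltr_pdivrMr// mulr_natr mulr2n ltrDl.
  exists c => // N.
  have : (c%:E < ereal_sup (u @` [set n | (N <= n)%N]))%E.
    apply: lt_le_trans cs _; apply: ereal_inf_lbound.
    by exists [set n | (N <= n)%N] => //; exists N.
  by move=> /ereal_sup_gt[_ [n /= Nn <-] /ltW cu]; exists n.
move=> [c c0 cu]; apply: (@lt_le_trans _ _ c%:E); first by rewrite lte_fin.
apply: le_ereal_inf_tmp => _ [V [N _ NV] <-].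
have [n Nn cn] := cu N; apply: le_trans cn _.
by apply: ereal_sup_ubound; exists n => //; exact: NV.
Qed.

(** A is contained in the union of C and [0, N), and the latter has N elements. *)
Lemma card_ord_eventual_subset (A C : set nat) (N n : nat) :
  (forall k, (N <= k)%N -> A k -> C k) ->
  (#|[pred a : 'I_n.+1 | (a : nat) \in A]| <=
   #|[pred a : 'I_n.+1 | (a : nat) \in C]| + N)%N.
Proof.
move=> AC.
have cN : (#|[pred a : 'I_n.+1 | (a < N)%N]| <= N)%N.
  rewrite -[leqRHS](size_iota 0) cardE -(size_map val).
  apply: uniq_leq_size.
    by rewrite map_inj_uniq ?enum_uniq//; exact: val_inj.
  by move=> _ /mapP[a + ->]; rewrite mem_enum mem_iota inE.
apply: leq_trans (leq_add (leqnn _) cN).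
rewrite -cardUI.
apply: leq_trans (leq_addr _ _).
apply: subset_leq_card; apply/fintype.subsetP => a; rewrite !inE => Aa.
case: (leqP N a) => [Na|]; last by rewrite orbT.
by rewrite orbF inE; apply: AC.
Qed.

(* Passing from A to C costs at most N / n in the density at n, hence at most
   half of any positive lower bound once n is large. *)
Lemma density_seq_eventual_subset (R : realType) (A C : set nat) (N : nat)
    (c : R) :
  (forall k, (N <= k)%N -> A k -> C k) -> 0 < c ->
  \forall n \near \oo, (c%:E <= density_seq R A n)%E ->
    ((c / 2)%:E <= density_seq R C n)%E.
Proof.
move=> AC c0; have c20 : 0 < c / 2 by rewrite divr_gt0.
near=> n; have n0 : 0 < n%:R :> R.
  by rewrite ltr0n; near: n; exact: nbhs_infty_gt.
rewrite !lee_fin !ler_pdivlMr// => cA.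
have Nn : N%:R <= c / 2 * n%:R.
  by rewrite mulrC -ler_pdivrMr//; near: n; exact: nbhs_infty_ger.
have : c * n%:R <= #|[pred a : 'I_n.+1 | (a : nat) \in C]|%:R + N%:R.
  apply: le_trans cA _; rewrite -natrD ler_nat.
  exact: card_ord_eventual_subset.
rewrite -lerBlDr; apply: le_trans.
rewrite lerBrDr; apply: le_trans (lerD (lexx _) Nn) _.
by rewrite -mulrDl -splitr.
Unshelve. all: by end_near. Qed.

Lemma lower_density_eventual_subset (R : realType) (A C : set nat) (N : nat) :
  (forall k, (N <= k)%N -> A k -> C k) ->
  (0 < lower_density R A)%E -> (0 < lower_density R C)%E.
Proof.
move=> AC /limn_einf_gt0P[c c0 cA]; apply/limn_einf_gt0P.
exists (c / 2); first by rewrite divr_gt0.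
exact: filterS2 (fun n => id) (density_seq_eventual_subset AC c0) cA.
Qed.

Lemma upper_density_eventual_subset (R : realType) (A C : set nat) (N : nat) :
  (forall k, (N <= k)%N -> A k -> C k) ->
  (0 < upper_density R A)%E -> (0 < upper_density R C)%E.
Proof.
move=> AC /limn_esup_gt0P[c c0 cA]; apply/limn_esup_gt0P.
exists (c / 2); first by rewrite divr_gt0.
have [N1 _ N1P] := density_seq_eventual_subset AC c0.
move=> N2; have [n + cn] := cA (maxn N1 N2).
by rewrite geq_max => /andP[N1n N2n]; exists n => //; exact: N1P.
Qed.

(** * Real and complex scalars *)

Lemma real_or_complex_rmorphism (R : realType) (K : numFieldType)
    (iota : R -> K) :
  real_or_complex iota -> exists f : {rmorphism R -> K}, iota = f.
Proof.
case=> {K iota}; first by exists (idfun : {rmorphism R -> R}).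
by exists (real_complex R : {rmorphism R -> R[i]}).
Qed.

Lemma ler_iota (R : realType) (K : numFieldType) (iota : R -> K) :
  real_or_complex iota -> {mono iota : x y / x <= y}.
Proof. by case=> {K iota} // x y; exact: lecR. Qed.

Lemma norm_iota (R : realType) (K : numFieldType) (iota : R -> K) :
  real_or_complex iota -> forall z : K, exists r, `|z| = iota r.
Proof.
case=> {K iota} z; first by exists `|z|.
by rewrite normc_def; eexists.
Qed.

(** Rationals, or complex numbers with rational real and imaginary parts, enumerated by [unpickle];
    a number that codes nothing gives 0. *)
Lemma countable_dense_scalars (R : realType) (K : numFieldType)
    (iota : R -> K) :
  real_or_complex iota ->
  exists d : nat -> K, forall (z e : K), 0 < e -> exists n, `|z - d n| < e.
Proof.
have ratR (x e : R) : 0 < e -> exists q : rat, `|x - ratr q| < e.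
  move=> e0; have [|q] := @rat_in_itvoo R (x - e) (x + e).
    by rewrite ltrD2l gtrN.
  rewrite in_itv/= => /andP[qx xq]; exists q.
  by rewrite distrC ltr_distl qx.
case=> {K iota}.
  exists (fun n => ratr (odflt 0 (unpickle n))) => z e e0.
  by have [q] := ratR z e e0; exists (pickle q); rewrite pickleK.
exists (fun n => let ab : rat * rat := odflt (0, 0) (unpickle n) in
  (ratr ab.1 +i* ratr ab.2)%C) => -[a b] e e0.
(* A positive element of [R[i]] is real; half of it is allotted to each of the real and imaginary
   parts. *)
have eE : e = (complex.Re e)%:C%C by rewrite RRe_real// gtr0_real.
have r0 : 0 < complex.Re e / 2.
  by rewrite divr_gt0// -ltcR -eE.
have [p pa] := ratR a _ r0; have [q qb] := ratR b _ r0.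
exists (pickle (p, q)); rewrite pickleK/=.
have nE (x y : R) : `|(x +i* y)%C| <= (`|x| + `|y|)%:C%C.
  rewrite [(x +i* y)%C]complexE /= rmorphD/=.
  apply: le_trans (ler_normD _ _) _; rewrite normrM.
  rewrite !normc_def/= !expr0n/= !addr0 add0r expr1n !sqrtr_sqr sqrtr1.
  by rewrite mul1r.
apply: le_lt_trans (nE _ _) _.
by rewrite eE ltcR [ltRHS]splitr ltrD.
Qed.

(** * Weight products and coordinates of the shift *)

Definition wprod (R : realType) (w : nat -> R) n := \prod_(1 <= i < n.+1) w i.

Lemma wprod_gt0 (R : realType) (w : nat -> R) n :
  (forall n, 0 < w n) -> 0 < wprod w n.
Proof. by move=> w0; apply: prodr_gt0. Qed.

Lemma c0_sumE (K : numFieldType) (I : Type) (r : seq I) (P : pred I)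
    (f : I -> c0 K) k :
  (\sum_(i <- r | P i) f i) k = \sum_(i <- r | P i) f i k.
Proof. by apply: (big_morph (fun y : c0 K => y k)). Qed.

(** B is prescribed only on basis vectors. The formula holds for truncations of x by linearity, and
    the remainder r has small image by continuity at 0. *)
Lemma weighted_shift_coord (K : numFieldType) (w : nat -> K)
    (B : {linear c0 K -> c0 K}) :
  is_weighted_shift w B -> forall x n, B x n = w n.+1 * x n.+1.
Proof.
move=> [Bc B0 BS] x n; apply/eqP; rewrite -subr_eq0 -normr_le0.
apply/ler_addgt0Pl => e e0; rewrite addr0.
have /cvgr0_norm_lt/(_ _ e0) : B z @[z --> 0] --> (0 : c0 K).
  by rewrite -{2}(linear0 B); exact: Bc.
move=> /nbhs_ballP[d /= d0 dB].
have /cvgr0Pnorm_lt/(_ _ d0)[N0 _ N0x] := @c0_cvg K x.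
(* The bound n + 2 keeps index n + 1 inside the truncation. *)
pose N := maxn N0 n.+2.
pose r := x - \sum_(i < N) x i *: c0_basis K i.
have rE k : r k = if (k < N)%N then 0 else x k.
  rewrite -[LHS]/(x k - (\sum_(i < N) x i *: c0_basis K i) k) c0_sumE.
  rewrite (eq_bigr (fun i : 'I_N =>
    if (i == k :> nat) then x k else 0)); last first.
    move=> i _; rewrite -[LHS]/(x i * (k == i)%:R) eq_sym.
    by case: eqP => [->|]; rewrite ?mulr1 ?mulr0.
  rewrite -big_mkcond/=; case: ltnP => kN.
    by rewrite (big_pred1 (Ordinal kN)) ?subrr// => i.
  rewrite big_pred0 ?subr0// => i; apply/eqP => ik.
  by have := ltn_ord i; rewrite ik ltnNge kN.
have Br : B r n = B x n - w n.+1 * x n.+1.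
  rewrite linearB linear_sum.
  rewrite -[LHS]/(B x n - (\sum_(i < N) B (x i *: c0_basis K i)) n).
  rewrite c0_sumE; congr (_ - _).
  have nN : (n.+1 < N)%N by rewrite leq_max ltnSn orbT.
  rewrite (bigD1 (Ordinal nN))//= linearZ BS big1 ?addr0.
    rewrite -[LHS]/(x n.+1 * (w n.+1 * (n == n)%:R)).
    by rewrite eqxx mulr1 mulrC.
  move=> [[|i] iN] /= ni; rewrite linearZ/= ?B0 ?BS.
    by rewrite scaler0.
  rewrite -[LHS]/(x i.+1 * (w i.+1 * (n == i)%:R)).
  have [ni'|_] := eqVneq n i; last by rewrite !mulr0.
  by move: ni; rewrite -val_eqE /= ni' eqxx.
rewrite -Br; apply: le_trans (c0_norm_ge _ _) _; apply: ltW.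
apply: (dB r); rewrite -ball_normE/= sub0r normrN.
have [m rm _] := c0_norm_attained r; rewrite [ltLHS](rm : `|r| = _) rE.
case: ltnP => [_|Nm]; first by rewrite normr0.
by apply: N0x => /=; apply: leq_trans Nm; exact: leq_maxl.
Qed.

(** Multiplying by W n makes the weights telescope and avoids quotients of products. *)
Lemma weighted_shift_iter (R : realType) (K : numFieldType)
    (f : {rmorphism R -> K}) (w : nat -> R) (B : {linear c0 K -> c0 K}) :
  is_weighted_shift (fun n => f (w n)) B -> forall k x n,
  f (wprod w n) * iter k B x n = f (wprod w (n + k)%N) * x (n + k)%N.
Proof.
move=> /weighted_shift_coord BE; elim=> [|k IH] x n; first by rewrite addn0.
rewrite iterS BE mulrA -rmorphM.
have -> : wprod w n * w n.+1 = wprod w n.+1 by rewrite /wprod [RHS]big_nat_recr.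
by rewrite IH addSnnS.
Qed.

(** * From an orbit to the sets E_p *)

Lemma finite_support_null_seq (K : numFieldType) (y : nat -> K) (N : nat) :
  (forall k, (N < k)%N -> y k = 0) -> y \in @null_seq K.
Proof.
move=> yN; apply/asboolP; apply: cvg_near_cst.
by exists N.+1 => // k /= Nk; exact: yN.
Qed.

Lemma natr_dist_lt1 (K : numDomainType) (i j : nat) :
  `|i%:R - j%:R : K| < 1 -> i = j.
Proof.
wlog ij : i j / (i <= j)%N => [H|].
  by case: (leqP i j) => [/H//|/ltnW/H{}H]; rewrite distrC => /H.
rewrite distrC -natrB// normr_nat ltrn1; lia.
Qed.

(** If p < q then p^2 + s <= p^2 + p < (p + 1)^2 <= q^2. *)
Lemma square_add_inj (p q s t : nat) : (s <= p)%N -> (t <= q)%N ->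
  (p ^ 2 + s)%N = (q ^ 2 + t)%N -> p = q /\ s = t.
Proof. 
move=> sp tq pqst.
suff pq : p = q by split=> //; move: pqst; rewrite pq => /addnI.
by case: (ltngtP p q) => // pq; have := leq_mul pq pq; rewrite !mulSn; lia.
 Qed.

(** The density enters only through its positivity on visit sets, so one proof serves both
    notions. *)
Lemma density_orbit_shift_condition (R : realType) (K : numFieldType)
    (f : {rmorphism R -> K}) (w : nat -> R) (B : {linear c0 K -> c0 K})
    (dens : set nat -> \bar R) (x : c0 K) :
  {mono f : a b / a <= b} -> (forall n, 0 < w n) ->
  is_weighted_shift (fun n => f (w n)) B ->
  (forall U : set (c0 K), open U -> U !=set0 ->
    (0 < dens [set n | U (iter n B x)])%E) ->
  shift_condition dens w.
Proof.
move=> f_le w0 /weighted_shift_iter BE densU.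
have f_lt : {mono f : a b / a < b} by exact: leW_mono f_le.
pose V n := f (wprod w n).
have V0 n : 0 < V n by rewrite -(rmorph0 f) f_lt wprod_gt0.
(* The successor gives b p s >= p + 1 for p >= 1, so a number within 1/2 of it still exceeds p + 1/2
   in modulus. *)
pose b p s := (p ^ 2 + s).+1.
pose yf p s := if (s <= p)%N then (b p s)%:R / V s else 0.
have yP p : yf p \in @null_seq K.
  apply: (@finite_support_null_seq _ _ p) => k.
  by rewrite /yf ltnNge => /negbTE->.
pose y p := MkC0 (yP p).
(* The inverse of D p is the radius of the ball. The sum keeps the error below 1/2 after
   multiplication by V s, s <= p; the term p bounds the coordinates beyond p by 1/p. *)
pose D p := p%:R + 2 * \sum_(s < p.+1) V s.
have D0 p : 0 < D p.
  apply: ltr_wpDl => //; apply: mulr_gt0 => //.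
  rewrite big_ord_recl; apply: ltr_pwDl => //.
  by apply: sumr_ge0 => s _; exact: ltW.
pose E p := [set n | ball (y p) (D p)^-1 (iter n B x)].
have Ecoord p n s : E p n -> `|yf p s - iter n B x s| < (D p)^-1.
  rewrite /E/= -ball_normE/=; apply: le_lt_trans.
  exact: (c0_norm_ge (y p - iter n B x) s).
have Elow p n s : E p n -> (s <= p)%N ->
    `|(b p s)%:R - V (n + s)%N * x (n + s)%N| < 2^-1.
  move=> En sp; have := Ecoord p n s En.
  rewrite -(ltr_pM2l (V0 s)) -{1}(gtr0_norm (V0 s)) -normrM mulrBr BE addnC.
  rewrite /yf sp mulrCA divff ?gt_eqF// mulr1 => /lt_le_trans; apply.
  rewrite ler_pdivrMr// -[leLHS]mul1r ler_pdivlMl// mul1r.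
  rewrite /D (bigD1 (Ordinal (sp : s < p.+1)%N))//=.
  rewrite mulrDr addrCA lerDl addr_ge0// mulr_ge0// sumr_ge0// => i _.
  exact: ltW.
have Ebig p n s : (0 < p)%N -> E p n -> (s <= p)%N ->
    p%:R + 2^-1 < `|V (n + s)%N * x (n + s)%N|.
  move=> p0 En sp; rewrite -(ltrD2r 2^-1) -addrA -div1r -splitr natr1.
  apply: (@le_lt_trans _ _ (b p s)%:R).
    by rewrite ler_nat ltnS (leq_trans _ (leq_addr _ _))// -mulnn leq_pmulr.
  rewrite -[ltLHS]normr_nat -[X in `|X|](subrK (V (n + s)%N * x (n + s)%N)).
  apply: le_lt_trans (ler_normD _ _) _; rewrite addrC ltrD2l div1r.
  exact: Elow.
have Ehigh p n s : E p n -> (p < s)%N ->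
    `|V (n + s)%N * x (n + s)%N| * p%:R <= V s.
  move=> En sp; have := Ecoord p n s En.
  rewrite /yf leqNgt sp/= sub0r normrN -(ltr_pM2l (V0 s)).
  rewrite -{1}(gtr0_norm (V0 s)) -normrM BE addnC => /ltW.
  rewrite ler_pdivlMr//; apply: le_trans; rewrite ler_wpM2l// lerDl.
  by rewrite mulr_ge0// sumr_ge0// => i _; exact: ltW.
have Einj p q n m s t : E p n -> E q m -> (s <= p)%N -> (t <= q)%N ->
    (n + s = m + t)%N -> p = q /\ s = t.
  move=> En Em sp tq nm; apply: square_add_inj => //; apply: succn_inj.
  apply: (@natr_dist_lt1 K).
  have h1 := Elow _ _ _ En sp.
  have := Elow _ _ _ Em tq; rewrite -!nm distrC => h2.
  rewrite [ltRHS]splitr div1r.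
  apply: le_lt_trans (ler_distD (V (n + s)%N * x (n + s)%N) _ _) _.
  exact: ltrD.
exists (fun p => p%:R), E; split; first by move=> p; rewrite ltr0n.
  exact: cvgr_idn.
split.
- move=> p _; apply: densU; first exact: ball_open.
  by exists (y p); apply: ballxx; rewrite invr_gt0.
- move=> p q p1 q1 pq; rewrite -subset0.
  move=> k [[n En [s sp nk]] [m Em [t tq mk]]].
  by apply: pq; have [] := Einj p q n m s t En Em sp tq; rewrite ?nk ?mk.
- move=> p p1; apply/cvgryPge => A.
  (* A' is a positive bound above A. From 1/2 < W k |x_k| and |x_k| < 1/(2 A') follows W k > A'. *)
  pose A' := `|A| + 1; have A0 : 0 < f A' by rewrite -(rmorph0 f) f_lt ltr_wpDl.
  have e0 : 0 < (2 * f A')^-1 by rewrite invr_gt0 mulr_gt0.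
  have /cvgr0Pnorm_lt/(_ _ e0)[N _ NP] := @c0_cvg K x.
  exists N => // k /= Nk [n En [s sp nk]].
  rewrite -/(wprod w k) -f_le.
  have := Ebig p n s p1 En sp; rewrite nk => Vx.
  have {}Vx : 2^-1 < V k * `|x k|.
    rewrite -[V k]gtr0_norm// -normrM; apply: le_lt_trans Vx.
    by rewrite lerDr.
  have {}Vx : 2^-1 < V k * (2 * f A')^-1.
    by apply: lt_trans Vx _; rewrite ltr_pM2l//; exact: NP.
  rewrite ltr_pdivlMr ?mulr_gt0// mulKf// in Vx.
  apply: le_trans (ltW Vx); rewrite f_le; apply: le_trans (ler_norm A) _.
  by rewrite lerDl.
- move=> p q n m t p1 q1 En Em nm tq.
  rewrite -/(wprod w _) -f_le rmorphM !rmorph_nat.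
  (* The number W (m + t) x_(m + t) is read twice: from m its modulus exceeds q, and from n its
     modulus times p is at most W (m - n + t). *)
  have nmt : (n + (m - n + t) = m + t)%N by lia.
  have [sp|ps] := leqP (m - n + t) p.
    have [_] := Einj _ _ _ _ _ _ En Em sp tq nmt; lia.
  apply: le_trans (Ehigh _ _ _ En ps); rewrite mulrC ler_wpM2r// nmt.
  by apply: ltW; apply: le_lt_trans (Ebig _ _ _ q1 Em tq); rewrite lerDl.
Qed.

(** * A dense sequence of finite sequences *)

Lemma injective_unbounded (h : nat -> nat) (m : nat) :
  injective h -> exists l, (m <= h l)%N.
Proof.
move=> h_inj; apply: contrapT => /forallNP hm.
have : (size (map h (iota 0 m.+1)) <= size (iota 0 m))%N.
  apply: uniq_leq_size; first by rewrite map_inj_uniq ?iota_uniq.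
  by move=> _ /mapP[l _ ->]; rewrite mem_iota add0n ltnNge; apply/negP/hm.
by rewrite size_map !size_iota ltnn.
Qed.

Lemma dense_finite_sequences (R : realType) (K : numFieldType)
    (iota : R -> K) :
  real_or_complex iota ->
  exists2 y : nat -> nat -> K, forall j k, (j < k)%N -> y j k = 0 &
    forall (z : c0 K) (e : K) J, 0 < e ->
      exists2 j, (J <= j)%N & forall k, `|z k - y j k| < e.
Proof.
move=> /countable_dense_scalars[d dP].
(* A code holds a list of indices into [d] and a padding number. Varying the padding gives the same
   list arbitrarily large codes j, beyond J and beyond the length of the list, so that the cut at j
   loses nothing. *)
pose dec j : nat * seq nat := odflt (0%N, [::]) (unpickle j).
exists (fun j k => if (k <= j)%N then nth 0 (map d (dec j).2) k else 0).
  by move=> j k; rewrite ltnNge => /negbTE ->.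
move=> z e J e0; have [g gP] := choice (fun k => dP (z k) e e0).
have /cvgr0Pnorm_lt/(_ _ e0)[N _ NP] := @c0_cvg K z.
have [l lP] : exists l : nat, (maxn J N <= pickle (l, mkseq g N))%N.
  apply: (@injective_unbounded (fun l => pickle (l, mkseq g N))) => a b.
  by move=> /(pcan_inj pickleK)[].
move: lP; rewrite geq_max => /andP[Jl Nl].
exists (pickle (l, mkseq g N)) => // k; rewrite /dec pickleK/=.
have [kN|Nk] := ltnP k N.
  rewrite (leq_trans (ltnW kN) Nl).
  by rewrite (nth_map 0%N) ?size_mkseq// nth_mkseq//; exact: gP.
rewrite nth_default ?size_map ?size_iota// if_same subr0; exact: NP.
Qed.

(** * From the sets E_p to a vector *)

Lemma shift_condition_density_orbit (R : realType) (K : numFieldType)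
    (f : {rmorphism R -> K}) (w : nat -> R) (B : {linear c0 K -> c0 K})
    (dens : set nat -> \bar R) (y : nat -> nat -> K) :
  {mono f : a b / a <= b} -> (forall z : K, exists r, `|z| = f r) ->
  (forall n, 0 < w n) ->
  is_weighted_shift (fun n => f (w n)) B ->
  (forall (A C : set nat) (N : nat), (forall k, (N <= k)%N -> A k -> C k) ->
    (0 < dens A)%E -> (0 < dens C)%E) ->
  (forall j k, (j < k)%N -> y j k = 0) ->
  (forall (z : c0 K) (e : K) J, 0 < e ->
    exists2 j, (J <= j)%N & forall k, `|z k - y j k| < e) ->
  shift_condition dens w ->
  exists x : c0 K, forall U : set (c0 K), open U -> U !=set0 ->
    (0 < dens [set n | U (iter n B x)])%E.
Proof.
move=> f_le f_norm w0 /weighted_shift_iter BE dens_sub y0 y_dense.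
move=> [M [E [M0 Moo [Edens Edisj Ew EM]]]].
have f_lt : {mono f : a b / a < b} by exact: leW_mono f_le.
pose V n := f (wprod w n).
have W0 n : 0 < wprod w n by exact: wprod_gt0.
have V0 n : 0 < V n by rewrite -(rmorph0 f) f_lt.
have [nrm nrmE] := choice f_norm.
have nrm0 z : 0 <= nrm z by rewrite -f_le rmorph0 -nrmE.
(* The Archimedean property is carried from R to K through the real-valued norm [nrm]. *)
have archi (e : K) : 0 < e -> exists J : nat, 1 < e * J.+1%:R.
  move=> e0; have ne0 : 0 < nrm e.
    by rewrite -f_lt rmorph0 -nrmE normr_gt0 gt_eqF.
  exists (Num.bound (nrm e)^-1).
  have eE : e = f (nrm e) by rewrite -nrmE gtr0_norm.
  rewrite {1}eE -(rmorph_nat f) -rmorphM -(rmorph1 f) f_lt.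
  rewrite -ltr_pdivrMl// mulr1.
  by apply: lt_le_trans (archi_boundP _) _; rewrite ?invr_ge0// ler_nat leqnSn.
(* For t <= j, c j dominates j + 1 (accuracy of visits), W t (disjoint blocks) and W t |y_j t| (size
   of x). *)
pose c j : R := j.+1%:R + \sum_(t < j.+1) wprod w t * (1 + nrm (y j t)).
have cterm j t : (t <= j)%N -> j.+1%:R + wprod w t * (1 + nrm (y j t)) <= c j.
  move=> tj; rewrite /c (bigD1 (Ordinal (tj : t < j.+1)%N))//= lerD2l lerDl.
  by apply: sumr_ge0 => i _; rewrite mulr_ge0 ?addr_ge0// ltW.
have cW j t : (t <= j)%N -> wprod w t < c j.
  move=> /cterm; apply: lt_le_trans; rewrite mulrDr mulr1 ltr_pwDl//.
  by rewrite lerDl mulr_ge0// ltW.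
have cy j t : (t <= j)%N -> wprod w t * nrm (y j t) <= c j.
  move=> /cterm; apply: le_trans; rewrite mulrDr mulr1 addrA lerDr.
  by rewrite addr_ge0// ltW.
have cge j : j.+1%:R <= c j.
  by apply: le_trans (cterm j 0%N isT); rewrite lerDl mulr_ge0 ?addr_ge0// ltW.
have c_gt0 j : 0 < c j by apply: lt_le_trans (cge j); rewrite ltr0n.
have [Q QP] : {Q : nat -> nat & forall j p, (Q j <= p)%N -> c j <= M p}.
  apply: (@choice _ _ (fun j P => forall p, (P <= p)%N -> c j <= M p)) => j.
  by have /cvgryPge/(_ (c j))[P _ PM] := Moo; exists P.
(* Summing Q i + 1 makes phi strictly increasing, above j and at least Q j, whence M (phi j) >= c
   j. *)
pose phi j := (\sum_(i < j.+1) (Q i).+1)%N.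
have phiS j : (phi j < phi j.+1)%N.
  by rewrite /phi [ltnRHS]big_ord_recr/= addnS ltnS leq_addr.
have phiQ j : (Q j <= phi j)%N.
  by rewrite /phi big_ord_recr/= (leq_trans (leqnSn _))// leq_addl.
have phi_inj : injective phi.
  exact/incn_inj/leq_mono/(homo_ltn ltn_trans phiS).
have phij j : (j < phi j)%N.
  by elim: j => [|j IH]; [rewrite /phi big_ord1|exact: leq_ltn_trans IH _].
have phi1 j : (1 <= phi j)%N by exact: leq_ltn_trans (phij j).
have Mphi j : c j <= M (phi j) by exact: QP.
have [Nf NfP] : {Nf : nat * R -> nat & forall jA k, (Nf jA <= k)%N ->
    interval_sum (E (phi jA.1)) (phi jA.1) k -> jA.2 <= wprod w k}.
  apply: (@choice _ _ (fun jA N => forall k, (N <= k)%N ->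
    interval_sum (E (phi jA.1)) (phi jA.1) k -> jA.2 <= wprod w k)) => -[j A].
  by have /cvgryPge/(_ A)[P _ PW] := Ew _ (phi1 j); exists P => k; exact: PW.
(* The threshold forces W k >= (j + 1) c_j on every block [m, m + j] with m in F_j. *)
pose F j := [set m | E (phi j) m /\ (Nf (j, (j.+1%:R * c j)%R) <= m)%N].
pose rep k j m := F j m /\ (m <= k <= m + j)%N.
have repE k j m : rep k j m -> interval_sum (E (phi j)) (phi j) k.
  move=> [[Em _] /andP[mk kj]]; exists m => //.
  exists (k - m)%N; last exact: subnKC.
  by rewrite /= leq_subLR (leq_trans kj)// leq_add2l ltnW.
(* Overlapping blocks of the same j would give m' - m <= j, hence W (m' - m) < c j <= M (phi j)^2,
   against (d) with t = 0. *)
have rep_ltF k j m m' : rep k j m -> rep k j m' -> (m < m')%N -> False.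
  move=> [[Em _] /andP[mk kj]] [[Em' _] /andP[mk' kj']] mm'.
  have := EM _ _ m m' 0%N (phi1 j) (phi1 j) Em Em' mm' isT.
  rewrite addn0 -/(wprod w _); apply/negP; rewrite -ltNge.
  have /cW/lt_le_trans : (m' - m <= j)%N by lia.
  apply; apply: le_trans (Mphi j) _.
  rewrite ler_peMr ?(le_trans _ (Mphi j)) ?(ltW (c_gt0 j))//.
  by rewrite (le_trans _ (cge j))// ler1n.
have rep_uniq k j m j' m' : rep k j m -> rep k j' m' -> j = j' /\ m = m'.
  move=> r r'.
  have jj' : j = j'.
    apply: contrapT => jj'.
    have /Edisj : phi j <> phi j' by move=> /phi_inj/jj'.
    move=> /(_ (phi1 _) (phi1 _)); apply/eqP/set0P; exists k.
    by split; [exact: repE _ _ _ r|exact: repE _ _ _ r'].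
  split=> //; move: r'; rewrite -jj' => r'.
  have rr' := rep_ltF _ _ _ _ r r'; have r'r := rep_ltF _ _ _ _ r' r.
  by case: (ltngtP m m') => // [/rr'|/r'r].
have [xf xP] : {xf : nat -> K & forall k,
    (forall j m, rep k j m -> V k * xf k = V (k - m)%N * y j (k - m)%N) /\
    ((forall j m, ~ rep k j m) -> xf k = 0)}.
  apply: (@choice _ _ (fun k v =>
    (forall j m, rep k j m -> V k * v = V (k - m)%N * y j (k - m)%N) /\
    ((forall j m, ~ rep k j m) -> v = 0))) => k.
  have [[j [m r]]|nr] := pselect (exists j m, rep k j m); last first.
    by exists 0; split=> // j m r; case: nr; exists j, m.
  exists (V (k - m)%N * y j (k - m)%N / V k); split; last by move=> /(_ j m).
  move=> j' m' r'; have [<- <-] := rep_uniq _ _ _ _ _ r r'.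
  by rewrite mulrCA divff ?mulr1// gt_eqF.
have Vx k j m : rep k j m -> V k * `|xf k| <= f (c j).
  move=> r; rewrite -(gtr0_norm (V0 k)) -normrM ((xP k).1 _ _ r) normrM.
  rewrite gtr0_norm// nrmE /V -rmorphM f_le; apply: cy.
  by case: r => _; lia.
have x_null : xf \in @null_seq K.
  apply/asboolP/cvgr0Pnorm_lt => e e0.
  have [J eJ] := archi e e0.
  (* Beyond this index W k >= (J + 1) c_j on every block: the sum covers the finitely many j < J,
     and the definition of F_j covers the others. As W k |x_k| <= c_j, this makes |x_k| < e. *)
  exists (\sum_(j < J) Nf (val j, (J.+1%:R * c (val j))%R))%N => // k /= Nk.
  have [[j [m r]]|nr] := pselect (exists j m, rep k j m); last first.
    by rewrite ((xP k).2 _) ?normr0// => j m r; case: nr; exists j, m.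
  have Wk : J.+1%:R * c j <= wprod w k.
    have [jJ|Jj] := ltnP j J.
      apply: (NfP (j, J.+1%:R * c j)); last exact: repE _ _ _ r.
      by apply: leq_trans Nk; rewrite (bigD1 (Ordinal jJ))//= leq_addr.
    apply: (@le_trans _ _ (j.+1%:R * c j)).
      by rewrite ler_pM2r// ler_nat.
    apply: (NfP (j, j.+1%:R * c j)); last exact: repE _ _ _ r.
    by case: r => -[_ /leq_trans Nm] /andP[mk _]; exact: Nm.
  have J0 : 0 < J.+1%:R :> K by rewrite ltr0n.
  rewrite -(ltr_pM2r J0); apply: le_lt_trans eJ.
  have fc0 : 0 < f (c j) by rewrite -(rmorph0 f) f_lt.
  rewrite -(ler_pM2r fc0) mul1r; apply: le_trans (Vx _ _ _ r).
  rewrite -mulrA mulrC ler_wpM2r//.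
  by rewrite -(rmorph_nat f) -rmorphM /V f_le.
pose x := MkC0 x_null.
(* The coordinate n + s of x comes from a block starting at m.  If m <= n then
   the block is the one of n itself; if m > n then (d) bounds (B^n x)_s. *)
have err i n s : F i n -> `|iter n B x s - y i s| * i.+1%:R <= 1.
  move=> Fin.
  have repi : (s <= i)%N -> rep (n + s)%N i n.
    by move=> si; split=> //; rewrite leq_addr leq_add2l.
  have Vs0 : V s != 0 by rewrite gt_eqF.
  have [[j [m r]]|nr] := pselect (exists j m, rep (n + s)%N j m); last first.
    have x0 : x (n + s)%N = 0.
      by apply: (xP (n + s)%N).2 => j m r; apply: nr; exists j, m.
    have -> : iter n B x s = 0.
      by apply: (mulfI Vs0); rewrite BE addnC x0 !mulr0.
    have [/repi r|si] := leqP s i; first by case: nr; exists i, n.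
    by rewrite y0// subrr normr0 mul0r.
  have xE : V s * iter n B x s = V (n + s - m)%N * y j (n + s - m)%N.
    by rewrite -((xP _).1 _ _ r) BE addnC.
  have [mn|nm|mn] := ltngtP m n.
  - have [_ nm] : i = j /\ n = m.
      apply: (@rep_uniq n); first by split=> //; rewrite leqnn leq_addr.
      by case: r => Fm mj; split=> //; lia.
    by rewrite nm ltnn in mn.
  - have si : (i < s)%N.
      rewrite ltnNge; apply/negP => /repi r'.
      by have [_ nm'] := rep_uniq _ _ _ _ _ r r'; rewrite nm' ltnn in nm.
    rewrite y0// subr0.
    have [[Em _] mj] := r.
    have := EM _ _ n m (n + s - m)%N (phi1 i) (phi1 j) Fin.1 Em nm.
    have -> : (m - n + (n + s - m) = s)%N by lia.
    have tj : (n + s - m <= j)%N by lia.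
    rewrite -/(wprod w _) => /(_ (leq_trans tj (ltnW (phij j)))) MM.
    (* By (d), W s >= M (phi i) M (phi j) >= (i + 1) c_j, while W s |(B^n x)_s| <= c_j. *)
    have fc0 : 0 < f (c j) by rewrite -(rmorph0 f) f_lt.
    rewrite -(ler_pM2r fc0) mul1r.
    apply: (@le_trans _ _ (`|V s * iter n B x s|)); last first.
      rewrite xE normrM gtr0_norm// nrmE /V -rmorphM f_le; exact: cy.
    rewrite normrM gtr0_norm// [leRHS]mulrC -mulrA ler_wpM2l//.
    rewrite -(rmorph_nat f) -rmorphM /V f_le; apply: le_trans MM.
    apply: ler_pM => //; first exact: ltW.
    exact: le_trans (cge i) (Mphi i).
  - have [ij _] : i = j /\ n = n.
      apply: (@rep_uniq n); first by split=> //; rewrite leqnn leq_addr.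
      by case: r; rewrite mn => Fm mj; split=> //; lia.
    move: xE; rewrite mn addKn -ij => /(mulfI Vs0) ->.
    by rewrite subrr normr0 mul0r.
exists x => U U_open [z Uz].
have /nbhs_ballP[e /= e0 zeU] : nbhs z U by exact: open_nbhs_nbhs.
have e20 : 0 < e / 2 by rewrite divr_gt0.
have [J eJ] := archi _ e20.
have [j Jj zy] := y_dense z _ J e20.
(* F_j contains all but finitely many elements of E_(phi j), so it suffices that its elements are
   visit times. *)
apply: (dens_sub _ _ (Nf (j, (j.+1%:R * c j)%R)) _ (Edens _ (phi1 j))).
move=> n Nn En.
apply: zeU.
rewrite -ball_normE/=.
have [k zk _] := c0_norm_attained (z - iter n B x).
rewrite [ltLHS](zk : `|z - _| = _) -[ltLHS]/(`|z k - iter n B x k|).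
apply: le_lt_trans (ler_distD (y j k) _ _) _.
rewrite [ltRHS]splitr; apply: ltrD; first exact: zy.
rewrite distrC.
have j0 : 0 < j.+1%:R :> K by rewrite ltr0n.
rewrite -(ltr_pM2r j0); apply: le_lt_trans (err _ _ _ (conj En Nn)) _.
by apply: lt_le_trans eJ _; rewrite ler_pM2l// ler_nat.
Qed.

Theorem theorem13 (R : realType) (K : numFieldType) (iota : R -> K)
    (w : nat -> R) (B : {linear c0 K -> c0 K}) :
  real_or_complex iota ->
  (forall n, 0 < w n) ->
  bounded_fun w ->
  is_weighted_shift (fun n => iota (w n)) B ->
  (frequently_hypercyclic R B <-> shift_condition (@lower_density R) w) /\
  (U_frequently_hypercyclic R B <-> shift_condition (@upper_density R) w).
Proof.
move=> iotaP w0 _ Bw.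
have iota_le := ler_iota iotaP; have iota_norm := norm_iota iotaP.
have [y ysupp ydense] := dense_finite_sequences iotaP.
have [f fE] := real_or_complex_rmorphism iotaP.
rewrite fE in iota_le iota_norm Bw.
split; split.
- by move=> [x]; exact: density_orbit_shift_condition.
- apply: (shift_condition_density_orbit _ _ _ Bw _ ysupp ydense) => //.
  exact: lower_density_eventual_subset.
- by move=> [x]; exact: density_orbit_shift_condition.
- apply: (shift_condition_density_orbit _ _ _ Bw _ ysupp ydense) => //.
  exact: upper_density_eventual_subset.
Qed.
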